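(* Let $\mathbb{K}$ be a field, $G=\mathbb{Z}=\langle g\rangle$ (written multiplicatively) and $R=\mathbb{K}_{par}G$. Then $IG=\bigcup_{k\ge1}V_k$, where each $V_k$ is a projective $R$-module, and $$IG\simeq\bigoplus_{k\ge1}P_k,$$ where $P_k=V_k/V_{k-1}$ is a projective left $R$-module and $V_0=0$. In particular, $IG$ is a projective $R$-module, hence $cd^{par}_{\mathbb{K}}(\mathbb{Z})=1$. Furthermore, $IG$ is not a finitely generated $R$-module and it is not a free left $R$-module.
   Context: For a group $G$, $\mathbb{K}_{par}G$ is the unital associative $\mathbb{K}$-algebra generated by symbols $[t]$, $t\in G$, subject to $[t][h][h^{-1}]=[th][h^{-1}]$, $[t^{-1}][t][h]=[t^{-1}][th]$ and $[1]=1$ for all $t,h\in G$. The elements $e_t=[t][t^{-1}]$ are pairwise commuting idempotents, and $B$ is the commutative subalgebra generated by $\{e_t\mid t\in G\}$; $B$ is a left $\mathbb{K}_{par}G$-module via $[t]\cdot b=[t]b[t^{-1}]$. As a left $B$-module, $\mathbb{K}_{par}G=\bigoplus_{t\in G}Be_t[t]$. The augmentation map is the homomorphism of left modules $\varepsilon:\mathbb{K}_{par}G\to B$ with $\varepsilon(b[t])=b$ for $b\in Be_t$, $t\in G$ (equivalently $\varepsilon(r)=r\cdot1$), and $IG=\mathrm{Ker}(\varepsilon)$, a left ideal of $\mathbb{K}_{par}G$. For $G=\mathbb{Z}=\langle g\rangle$ and $i\in\mathbb{Z}$ put $e_i=e_{g^i}$ and $f_i=[g^i]-e_i\in IG$ (so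 $e_0=1$, $f_0=0$). For $k\ge1$, $V_k=Rf_1+\dots+Rf_k\subseteq IG$, and $V_0=0$. $cd^{par}_{\mathbb{K}}(G)$ is the projective dimension of $B$ as a left $\mathbb{K}_{par}G$-module. *)

(* Defs.v *)
From HB Require Import structures.
From mathcomp Require Import all_boot all_order all_algebra generic_quotient.
From mathcomp Require Import ring_quotient.
From mathcomp Require Import boolp.

Set Implicit Arguments.
Unset Strict Implicit.
Unset Printing Implicit Defensive.

Import GRing.Theory.
Local Open Scope ring_scope.
Local Open Scope quotient_scope.

Section ModuleNotions.
Variable R : pzRingType.
Implicit Types M N : lmodType R.

Definition surjective_map (A C : Type) (f : A -> C) : Prop :=
  forall y, exists x, f x = y.

Definition mod_iso M N : Prop := exists f : {linear M -> N}, bijective f.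

Definition fin_gen M : Prop :=
  exists (n : nat) (s : 'I_n -> M),
    forall x, exists c : 'I_n -> R, x = \sum_(i < n) c i *: s i.

Definition projective (P : lmodType R) : Prop :=
  forall M N (f : {linear M -> N}) (g : {linear P -> N}),
    surjective_map f -> exists h : {linear P -> M}, forall x, f (h x) = g x.

(* M has a projective resolution
     0 -> P_n -> ... -> P_1 -> P_0 -> M -> 0. *)
Definition pdim_le M (n : nat) : Prop :=
  exists (P : nat -> lmodType R) (d : forall i, {linear P i.+1 -> P i})
         (aug : {linear P 0%N -> M}),
  [/\ forall i, projective (P i),
      surjective_map aug,
      forall x, aug x = 0 <-> exists y, d 0%N y = x,
      forall i x, d i x = 0 <-> exists y, d i.+1 y = x
    & forall i, (n < i)%N -> forall x : P i, x = 0].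

(* The projective dimension of M is n (in particular, it is finite). *)
Definition is_pdim M (n : nat) : Prop :=
  pdim_le M n /\ forall m, pdim_le M m -> (n <= m)%N.

End ModuleNotions.

Definition submod (R : pzRingType) (M : lmodType R) (S : submodClosed M) :=
  {x : M | x \in S}.
HB.instance Definition _ (R : pzRingType) (M : lmodType R)
  (S : submodClosed M) := SubChoice.on (submod S).
HB.instance Definition _ (R : pzRingType) (M : lmodType R)
  (S : submodClosed M) := [SubChoice_isSubLmodule of submod S by <:].

Section Kernel.
Variables (R : pzRingType) (M N : lmodType R) (f : {linear M -> N}).

Definition kerp : {pred M} := fun x => f x == 0.

Lemma kerp_closed : submod_closed kerp.
Proof.
split=> [|a u v]; rewrite !unfold_in ?raddf0 // => /eqP fu /eqP fv.
by rewrite linearP fu fv scaler0 addr0.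
Qed.

HB.instance Definition _ := GRing.isSubmodClosed.Build R M kerp kerp_closed.

End Kernel.

(* The trace of T on the submodule S; if T is contained in S, this is T seen as
   a submodule of S. *)
Section Trace.
Variables (R : pzRingType) (M : lmodType R) (S T : submodClosed M).

Definition trace_in : {pred submod S} := fun x => val x \in T.

Lemma trace_in_closed : submod_closed trace_in.
Proof.
have trE x : (x \in trace_in) = (val x \in T) by [].
split=> [|a u v]; rewrite !trE ?raddf0 ?rpred0 // => uT vT.
by rewrite linearP rpredD // rpredZ.
Qed.

HB.instance Definition _ :=
  GRing.isSubmodClosed.Build R (submod S) trace_in trace_in_closed.

End Trace.
Arguments trace_in {R M} S T x.

Section QuotientModule.
Variables (R : pzRingType) (M : lmodType R) (S : submodClosed M).

(* submodClosed does not inherit from zmodClosed in the library. *)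
Definition submod_zmod : {pred M} := fun x => x \in S.

Lemma submod_zmod_closed : zmod_closed submod_zmod.
Proof. exact: GRing.submod_closedB (submodClosedP S). Qed.

HB.instance Definition _ :=
  GRing.isZmodClosed.Build M submod_zmod submod_zmod_closed.

Definition quotmod := Quotient.quot submod_zmod.
HB.instance Definition _ := GRing.Zmodule.on quotmod.

Definition quotmod_pi (x : M) : quotmod := \pi_(Quotient.quot submod_zmod) x.

Lemma quotmod_pi_eq x y : (quotmod_pi x = quotmod_pi y) <-> (x - y \in S).
Proof.
rewrite /quotmod_pi -[x - y \in S]/(x - y \in submod_zmod) Quotient.idealrBE.
by split=> /eqP.
Qed.

Lemma quotmod_piD x y : quotmod_pi (x + y) = quotmod_pi x + quotmod_pi y.
Proof. exact: (Quotient.pi_add submod_zmod). Qed.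

Definition quotmod_repr (x : quotmod) : M :=
  repr (x : Quotient.quot submod_zmod).

Lemma quotmod_reprK (x : quotmod) : quotmod_pi (quotmod_repr x) = x.
Proof. exact: reprK. Qed.

Definition quotmod_scale (a : R) (x : quotmod) : quotmod :=
  quotmod_pi (a *: quotmod_repr x).

Lemma quotmod_piZ a x :
  quotmod_pi (a *: x) = quotmod_scale a (quotmod_pi x).
Proof.
apply/quotmod_pi_eq; rewrite -scalerBr rpredZ //.
by apply/quotmod_pi_eq; rewrite quotmod_reprK.
Qed.

Lemma quotmod_scalerA a b v :
  quotmod_scale a (quotmod_scale b v) = quotmod_scale (a * b) v.
Proof. by rewrite -[v]quotmod_reprK -!quotmod_piZ scalerA. Qed.

Lemma quotmod_scale1r : left_id 1 quotmod_scale.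
Proof. by move=> v; rewrite -[v]quotmod_reprK -!quotmod_piZ scale1r. Qed.

Lemma quotmod_scalerDr : right_distributive quotmod_scale +%R.
Proof.
move=> a u v; rewrite -[u]quotmod_reprK -[v]quotmod_reprK.
by rewrite -quotmod_piD -!quotmod_piZ -quotmod_piD scalerDr.
Qed.

Lemma quotmod_scalerDl v : {morph quotmod_scale^~ v : a b / a + b}.
Proof.
move=> a b /=; rewrite -[v]quotmod_reprK -!quotmod_piZ.
by rewrite -quotmod_piD scalerDl.
Qed.

HB.instance Definition _ := GRing.Zmodule_isLmodule.Build R quotmod
  quotmod_scalerA quotmod_scale1r quotmod_scalerDr quotmod_scalerDl.

End QuotientModule.

(* S / (S :&: T), i.e., S / T when T is contained in S. *)
Definition subquot (R : pzRingType) (M : lmodType R) (S T : submodClosed M) :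
  lmodType R := quotmod (trace_in S T).

Section DirectProduct.
Variables (R : pzRingType) (I : Type) (P : I -> lmodType R).

Definition dprodmod := forall i, P i.
HB.instance Definition _ := Choice.copy dprodmod (forall i, P i).

Implicit Types f g h : dprodmod.
Definition dprod_add f g : dprodmod := fun i => f i + g i.
Definition dprod_opp f : dprodmod := fun i => - f i.
Definition dprod_zero : dprodmod := fun i => 0.
Definition dprod_scale (a : R) f : dprodmod := fun i => a *: f i.

Lemma dprod_addA : associative dprod_add.
Proof. by move=> f g h; apply: functional_extensionality_dep => i; apply: addrA. Qed.
Lemma dprod_addC : commutative dprod_add.
Proof. by move=> f g; apply: functional_extensionality_dep => i; apply: addrC. Qed.
Lemma dprod_add0 : left_id dprod_zero dprod_add.
Proof. by move=> f; apply: functional_extensionality_dep => i; apply: add0r. Qed.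
Lemma dprod_addN : left_inverse dprod_zero dprod_opp dprod_add.
Proof. by move=> f; apply: functional_extensionality_dep => i; apply: addNr. Qed.

HB.instance Definition _ := GRing.isZmodule.Build dprodmod
  dprod_addA dprod_addC dprod_add0 dprod_addN.

Lemma dprod_scalerA a b f :
  dprod_scale a (dprod_scale b f) = dprod_scale (a * b) f.
Proof. by apply: functional_extensionality_dep => i; apply: scalerA. Qed.
Lemma dprod_scale1r : left_id 1 dprod_scale.
Proof. by move=> f; apply: functional_extensionality_dep => i; apply: scale1r. Qed.
Lemma dprod_scalerDr : right_distributive dprod_scale +%R.
Proof. by move=> a f g; apply: functional_extensionality_dep => i; apply: scalerDr. Qed.
Lemma dprod_scalerDl f : {morph dprod_scale^~ f : a b / a + b}.
Proof. by move=> a b; apply: functional_extensionality_dep => i; apply: scalerDl. Qed.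

HB.instance Definition _ := GRing.Zmodule_isLmodule.Build R dprodmod
  dprod_scalerA dprod_scale1r dprod_scalerDr dprod_scalerDl.

End DirectProduct.

Section DirectSum.
Variables (R : pzRingType) (I : eqType) (P : I -> lmodType R).

Definition finite_support : {pred dprodmod P} :=
  fun f => `[< exists s : seq I, forall i, i \notin s -> f i = 0 >].

Lemma finite_support_closed : submod_closed finite_support.
Proof.
split=> [|a u v]; rewrite !unfold_in; first by apply/asboolP; exists [::].
move=> /asboolP[s sP] /asboolP[t tP]; apply/asboolP; exists (s ++ t) => i.
rewrite mem_cat negb_or => /andP[/sP u0 /tP v0].
by rewrite -[LHS]/(a *: u i + v i) u0 v0 scaler0 addr0.
Qed.

HB.instance Definition _ := GRing.isSubmodClosed.Build R (dprodmod P)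
  finite_support finite_support_closed.

Definition dsum : lmodType R := submod finite_support.

End DirectSum.

Definition free_mod (R : pzRingType) (M : lmodType R) : Prop :=
  exists I : eqType, mod_iso M (dsum (fun _ : I => R^o : lmodType R)).

Section PartialGroupAlgebra.
Variables (K : fieldType) (G : groupType).

(* Noncommutative polynomial expressions in the symbols [t], t in G, with
   coefficients in K. *)
Inductive kterm :=
  | KGen of G
  | KConst of K
  | KAdd of kterm & kterm
  | KMul of kterm & kterm.

(* The least congruence containing the axioms of unital associative K-algebras
   and the defining relations of the partial group algebra; the additive
   inverse of u is represented by (-1) u. *)
Inductive krel : kterm -> kterm -> Prop :=
  | KRefl u : krel u u
  | KSym u v : krel u v -> krel v u
  | KTrans u v w : krel u v -> krel v w -> krel u w
  | KAddCong u u' v v' : krel u u' -> krel v v' -> krel (KAdd u v) (KAdd u' v')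
  | KMulCong u u' v v' : krel u u' -> krel v v' -> krel (KMul u v) (KMul u' v')
  | KAddA u v w : krel (KAdd u (KAdd v w)) (KAdd (KAdd u v) w)
  | KAddC u v : krel (KAdd u v) (KAdd v u)
  | KAdd0 u : krel (KAdd (KConst 0) u) u
  | KMulA u v w : krel (KMul u (KMul v w)) (KMul (KMul u v) w)
  | KMul1l u : krel (KMul (KConst 1) u) u
  | KMul1r u : krel (KMul u (KConst 1)) u
  | KMulDl u v w : krel (KMul (KAdd u v) w) (KAdd (KMul u w) (KMul v w))
  | KMulDr u v w : krel (KMul u (KAdd v w)) (KAdd (KMul u v) (KMul u w))
  | KMul0 u : krel (KMul (KConst 0) u) (KConst 0)
  | KConstD a b : krel (KConst (a + b)) (KAdd (KConst a) (KConst b))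
  | KConstM a b : krel (KConst (a * b)) (KMul (KConst a) (KConst b))
  | KConstC a u : krel (KMul (KConst a) u) (KMul u (KConst a))
  | KGenR t h :
      krel (KMul (KMul (KGen t) (KGen h)) (KGen h^-1%g))
           (KMul (KGen (t * h)%g) (KGen h^-1%g))
  | KGenL t h :
      krel (KMul (KMul (KGen t^-1%g) (KGen t)) (KGen h))
           (KMul (KGen t^-1%g) (KGen (t * h)%g))
  | KGen1 : krel (KGen 1%g) (KConst 1).

HB.instance Definition _ := gen_eqMixin kterm.
HB.instance Definition _ := gen_choiceMixin kterm.

Definition krelb : rel kterm := fun u v => `[< krel u v >].

Lemma krelb_refl : reflexive krelb.
Proof. by move=> u; apply/asboolP/KRefl. Qed.
Lemma krelb_sym : symmetric krelb.
Proof. by move=> u v; apply/asboolP/asboolP => /KSym. Qed.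
Lemma krelb_trans : transitive krelb.
Proof.
by move=> v u w /asboolP uv /asboolP vw; apply/asboolP/(KTrans uv vw).
Qed.

Canonical krelb_equiv := EquivRel krelb krelb_refl krelb_sym krelb_trans.

Definition kpar := {eq_quot krelb}.
HB.instance Definition _ := Choice.on kpar.
HB.instance Definition _ := EqQuotient.on kpar.

Definition kcls (u : kterm) : kpar := \pi_kpar u.

Lemma kcls_eq u v : kcls u = kcls v <-> krel u v.
Proof.
by split=> [/eqmodP/asboolP|uv] //; apply/eqmodP/asboolP.
Qed.

Lemma kclsE u v : krel u v -> kcls u = kcls v.
Proof. by move/kcls_eq. Qed.

Lemma krepr (x : kpar) : kcls (repr x) = x.
Proof. exact: reprK. Qed.

Lemma kcls_surj (x : kpar) : exists u, x = kcls u.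
Proof. by exists (repr x); rewrite krepr. Qed.

Definition kadd (x y : kpar) := kcls (KAdd (repr x) (repr y)).
Definition kmul (x y : kpar) := kcls (KMul (repr x) (repr y)).
Definition kopp (x : kpar) := kmul (kcls (KConst (-1))) x.
Definition kscale (a : K) (x : kpar) := kmul (kcls (KConst a)) x.

Lemma krepr_cls u : krel (repr (kcls u)) u.
Proof. by apply/kcls_eq; rewrite krepr. Qed.

Lemma kclsD u v : kadd (kcls u) (kcls v) = kcls (KAdd u v).
Proof. by apply/kcls_eq; apply: KAddCong; apply: krepr_cls. Qed.

Lemma kclsM u v : kmul (kcls u) (kcls v) = kcls (KMul u v).
Proof. by apply/kcls_eq; apply: KMulCong; apply: krepr_cls. Qed.

Lemma kaddA : associative kadd.
Proof.
move=> x y z; have [[[u ->] [v ->]] [w ->]] := (kcls_surj x, kcls_surj y, kcls_surj z).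
by rewrite !kclsD; apply/kcls_eq/KAddA.
Qed.
Lemma kaddC : commutative kadd.
Proof.
move=> x y; have [[u ->] [v ->]] := (kcls_surj x, kcls_surj y).
by rewrite !kclsD; apply/kcls_eq/KAddC.
Qed.
Lemma kadd0 : left_id (kcls (KConst 0)) kadd.
Proof. by move=> x; have [u ->] := kcls_surj x; rewrite kclsD; apply/kcls_eq/KAdd0. Qed.
Lemma kmulA : associative kmul.
Proof.
move=> x y z; have [[[u ->] [v ->]] [w ->]] := (kcls_surj x, kcls_surj y, kcls_surj z).
by rewrite !kclsM; apply/kcls_eq/KMulA.
Qed.
Lemma kmul1l : left_id (kcls (KConst 1)) kmul.
Proof. by move=> x; have [u ->] := kcls_surj x; rewrite kclsM; apply/kcls_eq/KMul1l. Qed.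
Lemma kmul1r : right_id (kcls (KConst 1)) kmul.
Proof. by move=> x; have [u ->] := kcls_surj x; rewrite kclsM; apply/kcls_eq/KMul1r. Qed.
Lemma kmulDl : left_distributive kmul kadd.
Proof.
move=> x y z; have [[[u ->] [v ->]] [w ->]] := (kcls_surj x, kcls_surj y, kcls_surj z).
by rewrite !(kclsM, kclsD); apply/kcls_eq/KMulDl.
Qed.
Lemma kmulDr : right_distributive kmul kadd.
Proof.
move=> x y z; have [[[u ->] [v ->]] [w ->]] := (kcls_surj x, kcls_surj y, kcls_surj z).
by rewrite !(kclsM, kclsD); apply/kcls_eq/KMulDr.
Qed.
Lemma kaddN : left_inverse (kcls (KConst 0)) kopp kadd.
Proof.
move=> x; rewrite /kopp -{2}[x]kmul1l -kmulDl kclsD.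
rewrite -(kclsE (KConstD (-1) 1)) addNr; have [u ->] := kcls_surj x.
by rewrite kclsM; apply/kcls_eq/KMul0.
Qed.

HB.instance Definition _ :=
  GRing.isZmodule.Build kpar kaddA kaddC kadd0 kaddN.

(* Evaluation of expressions; used for the universal property below. *)
Fixpoint keval (A : algType K) (phi : G -> A) (u : kterm) : A :=
  match u with
  | KGen t => phi t
  | KConst a => a%:A
  | KAdd v w => keval phi v + keval phi w
  | KMul v w => keval phi v * keval phi w
  end.

Definition partial_rep (A : algType K) (phi : G -> A) : Prop :=
  [/\ forall t h, phi t * phi h * phi h^-1%g = phi (t * h)%g * phi h^-1%g,
      forall t h, phi t^-1%g * phi t * phi h = phi t^-1%g * phi (t * h)%g
    & phi 1%g = 1].

Lemma keval_rel (A : algType K) (phi : G -> A) u v :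
  partial_rep phi -> krel u v -> keval phi u = keval phi v.
Proof.
case=> phiR phiL phi1; elim=> {u v} //=.
- by move=> u v w _ -> _ ->.
- by move=> u u' v v' _ -> _ ->.
- by move=> u u' v v' _ -> _ ->.
- by move=> u v w; rewrite addrA.
- by move=> u v; rewrite addrC.
- by move=> u; rewrite scale0r add0r.
- by move=> u v w; rewrite mulrA.
- by move=> u; rewrite scale1r mul1r.
- by move=> u; rewrite scale1r mulr1.
- by move=> u v w; rewrite mulrDl.
- by move=> u v w; rewrite mulrDr.
- by move=> u; rewrite scale0r mul0r.
- by move=> a b; rewrite scalerDl.
- by move=> a b; rewrite mulr_algl scalerA.
- by move=> a u; rewrite mulr_algl mulr_algr.
- by rewrite scale1r.
Qed.

Lemma kone_neq0 : kcls (KConst 1) != kcls (KConst 0).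
Proof.
apply/eqP => /kcls_eq.
have pr1 : partial_rep (fun _ : G => 1 : K^o).
  by split=> // *; rewrite !mulr1.
by move/(keval_rel pr1)/eqP; rewrite /= scale0r scale1r oner_eq0.
Qed.

HB.instance Definition _ := GRing.Zmodule_isNzRing.Build kpar
  kmulA kmul1l kmul1r kmulDl kmulDr kone_neq0.

Lemma kscalerA a b v : kscale a (kscale b v) = kscale (a * b) v.
Proof. by rewrite /kscale kmulA kclsM -(kclsE (KConstM a b)). Qed.
Lemma kscale1r : left_id 1 kscale.
Proof. exact: kmul1l. Qed.
Lemma kscalerDr : right_distributive kscale +%R.
Proof. by move=> a; apply: kmulDr. Qed.
Lemma kscalerDl v : {morph kscale^~ v : a b / a + b}.
Proof.
move=> a b; by rewrite /kscale (kclsE (KConstD a b)) -kclsD kmulDl.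
Qed.

HB.instance Definition _ := GRing.Zmodule_isLmodule.Build K kpar
  kscalerA kscale1r kscalerDr kscalerDl.

Lemma kscalerAl (a : K) (u v : kpar) : a *: (u * v) = (a *: u) * v.
Proof. exact: kmulA. Qed.

HB.instance Definition _ := GRing.Lmodule_isLalgebra.Build K kpar kscalerAl.

Lemma kscalerAr (a : K) (x y : kpar) : a *: (x * y) = x * (a *: y).
Proof.
have [[u ->] [v ->]] := (kcls_surj x, kcls_surj y).
have aC : kmul (kcls (KConst a)) (kcls u) = kmul (kcls u) (kcls (KConst a)).
  by rewrite !kclsM; apply/kcls_eq/KConstC.
by rewrite -[LHS]/(kmul _ (kmul _ _)) kmulA aC -kmulA.
Qed.

HB.instance Definition _ := GRing.Lalgebra_isAlgebra.Build K kpar kscalerAr.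

Lemma kcls_addE u v : kcls u + kcls v = kcls (KAdd u v).
Proof. exact: kclsD. Qed.
Lemma kcls_mulE u v : kcls u * kcls v = kcls (KMul u v).
Proof. exact: kclsM. Qed.

Definition kgen (t : G) : kpar := kcls (KGen t).

Lemma kgen_rep : partial_rep kgen.
Proof.
split=> [t h|t h|]; last exact/kclsE/KGen1.
  by rewrite 2!(kcls_mulE (KGen _)) (kcls_mulE (KMul _ _)); apply/kclsE/KGenR.
by rewrite 2!(kcls_mulE (KGen _)) (kcls_mulE (KMul _ _)); apply/kclsE/KGenL.
Qed.

(* The universal property: the partial group algebra is the unital associative
   K-algebra generated by the kgen t, subject to partial_rep. *)
Definition klift (A : algType K) (phi : G -> A) (x : kpar) : A :=
  keval phi (repr x).

Lemma kcls_constE a : kcls (KConst a) = a%:A.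
Proof. by rewrite -[RHS]/(kmul _ _) kmul1r. Qed.

Lemma klift_cls (A : algType K) (phi : G -> A) u :
  partial_rep phi -> klift phi (kcls u) = keval phi u.
Proof. by move=> pr; apply: keval_rel => //; apply: krepr_cls. Qed.

Lemma klift_universal (A : algType K) (phi : G -> A) : partial_rep phi ->
  [/\ forall t, klift phi (kgen t) = phi t,
      linear (klift phi) & monoid_morphism (klift phi)].
Proof.
move=> pr; split=> [t|a x y|].
- exact: klift_cls.
- have [[u ->] [v ->]] := (kcls_surj x, kcls_surj y).
  rewrite -[a *: kcls u]/(kcls (KConst a) * kcls u) (kcls_mulE _ u) (kcls_addE _ v).
  by rewrite !klift_cls //= mulr_algl.
- split=> [|x y]; first by rewrite klift_cls //= scale1r.
  have [[u ->] [v ->]] := (kcls_surj x, kcls_surj y).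
  by rewrite (kcls_mulE u v) !klift_cls.
Qed.

Lemma kpar_ind (Q : kpar -> Prop) :
  (forall t, Q (kgen t)) -> (forall a, Q a%:A) ->
  (forall x y, Q x -> Q y -> Q (x + y)) ->
  (forall x y, Q x -> Q y -> Q (x * y)) -> forall x, Q x.
Proof.
move=> Qg Qc QD QM x; have [u ->] := kcls_surj x; elim: u => [t|a|u Qu v Qv|u Qu v Qv].
- exact: Qg.
- by rewrite kcls_constE.
- by rewrite -kcls_addE; apply: QD.
- by rewrite -kcls_mulE; apply: QM.
Qed.

Lemma klift_unique (A : algType K) (f1 f2 : {lrmorphism kpar -> A}) :
  (forall t, f1 (kgen t) = f2 (kgen t)) -> f1 =1 f2.
Proof.
move=> f12; apply: kpar_ind => [t|a|x y fx fy|x y fx fy].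
- exact: f12.
- by rewrite !rmorph_alg.
- by rewrite !raddfD; congr (_ + _).
- by rewrite !rmorphM; congr (_ * _).
Qed.

Definition kidem (t : G) : kpar := kgen t * kgen t^-1%g.

(* The subalgebra B generated by the idempotents kidem t. *)
Definition in_kB : {pred kpar} := fun x =>
  `[< forall S : {pred kpar}, GRing.subalg_closed S ->
        (forall t, kidem t \in S) -> x \in S >].

Lemma in_kB_closed : GRing.subalg_closed in_kB.
Proof.
split=> [|a u v|u v]; rewrite !unfold_in.
- by apply/asboolP => S [].
- move=> /asboolP uB /asboolP vB; apply/asboolP => S Scl Se.
  by have [_ + _] := Scl; apply; [apply: uB | apply: vB].
- move=> /asboolP uB /asboolP vB; apply/asboolP => S Scl Se.
  by have [_ _] := Scl; apply; [apply: uB | apply: vB].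
Qed.

HB.instance Definition _ := GRing.isSubalgClosed.Build K kpar in_kB in_kB_closed.

Lemma kidem_in_kB t : kidem t \in in_kB.
Proof. by rewrite unfold_in; apply/asboolP. Qed.

Lemma in_kB_ind (Q : kpar -> Prop) :
  Q 1 -> (forall t, Q (kidem t)) ->
  (forall a x y, Q x -> Q y -> Q (a *: x + y)) ->
  (forall x y, Q x -> Q y -> Q (x * y)) -> forall x, x \in in_kB -> Q x.
Proof.
move=> Q1 Qe QD QM x; rewrite unfold_in => /asboolP/(_ (fun y => `[< Q y >])).
rewrite unfold_in => xQ; apply/asboolP/xQ => [|t]; last by rewrite unfold_in; apply/asboolP.
split=> [|a u v|u v]; rewrite !unfold_in; first exact/asboolP.
  by move=> /asboolP Qu /asboolP Qv; apply/asboolP/QD.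
by move=> /asboolP Qu /asboolP Qv; apply/asboolP/QM.
Qed.

Lemma kgenR t h : kgen t * kgen h * kgen h^-1%g = kgen (t * h)%g * kgen h^-1%g.
Proof. by have [] := kgen_rep. Qed.
Lemma kgenL t h : kgen t^-1%g * kgen t * kgen h = kgen t^-1%g * kgen (t * h)%g.
Proof. by have [] := kgen_rep. Qed.
Lemma kgen1 : kgen 1%g = 1.
Proof. by have [] := kgen_rep. Qed.

Lemma kgenL' t h : kgen t * kgen t^-1%g * kgen h = kgen t * kgen (t^-1 * h)%g.
Proof. by have := kgenL t^-1%g h; rewrite invgK. Qed.

Lemma kgen_idemr t : kgen t * kidem t^-1%g = kgen t.
Proof. by rewrite /kidem invgK mulrA kgenL' mulVg kgen1 mulr1. Qed.

Lemma kidem_gen t : kidem t * kgen t = kgen t.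
Proof. by rewrite -{2}[kgen t]kgen_idemr /kidem invgK mulrA. Qed.

Lemma kgen_kidem t s : kgen t * kidem s = kidem (t * s)%g * kgen t.
Proof.
by rewrite /kidem mulrA kgenR kgenL' invgM -mulgA mulVg mulg1.
Qed.

Lemma kidem_idem t : kidem t * kidem t = kidem t.
Proof. by rewrite {2 3}/kidem mulrA kidem_gen. Qed.

Lemma kidemC t s : kidem t * kidem s = kidem s * kidem t.
Proof. by rewrite {1}/kidem -mulrA kgen_kidem mulrA kgen_kidem mulVKg -mulrA. Qed.

Lemma in_kB_comm_kidem b t : b \in in_kB -> kidem t * b = b * kidem t.
Proof.
move: b; apply: in_kB_ind => [|s|a x y xC yC|x y xC yC].
- by rewrite mulr1 mul1r.
- exact: kidemC.
- by rewrite mulrDl mulrDr -scalerAl -scalerAr xC yC.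
- by rewrite mulrA xC -mulrA yC mulrA.
Qed.

Lemma in_kB_comm b c : b \in in_kB -> c \in in_kB -> b * c = c * b.
Proof.
move=> bB; move: c; apply: in_kB_ind => [|s|a x y xC yC|x y xC yC].
- by rewrite mulr1 mul1r.
- by rewrite in_kB_comm_kidem.
- by rewrite mulrDl mulrDr -scalerAl -scalerAr xC yC.
- by rewrite mulrA xC -mulrA yC mulrA.
Qed.

(* The action [t] . b = [t] b [t^-1] of the generators, extended to expressions.
   It satisfies the defining relations on the whole algebra. *)
Fixpoint kact_term (u : kterm) (b : kpar) : kpar :=
  match u with
  | KGen t => kgen t * b * kgen t^-1%g
  | KConst a => a *: b
  | KAdd v w => kact_term v b + kact_term w b
  | KMul v w => kact_term v (kact_term w b)
  end.

Lemma kact_termD u : {morph kact_term u : b c / b + c}.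
Proof.
move=> b c; elim: u b c => [t|a|u IHu v IHv|u IHu v IHv] b c /=.
- by rewrite mulrDr mulrDl.
- by rewrite scalerDr.
- by rewrite IHu IHv addrACA.
- by rewrite IHv IHu.
Qed.

Lemma kact_termZ u a b : kact_term u (a *: b) = a *: kact_term u b.
Proof.
elim: u b => [t|c|u IHu v IHv|u IHu v IHv] b /=.
- by rewrite -scalerAr -scalerAl.
- by rewrite !scalerA mulrC.
- by rewrite IHu IHv scalerDr.
- by rewrite IHv IHu.
Qed.

Lemma kact_rel u v b : krel u v -> kact_term u b = kact_term v b.
Proof.
move=> uv; elim: uv b => {u v} //=.
- by move=> u v w _ uv _ vw b; rewrite uv.
- by move=> u u' v v' _ uu' _ vv' b; rewrite uu' vv'.
- by move=> u u' v v' _ uu' _ vv' b; rewrite vv' uu'.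
- by move=> u v w b; rewrite addrA.
- by move=> u v b; rewrite addrC.
- by move=> u b; rewrite scale0r add0r.
- by move=> u b; rewrite scale1r.
- by move=> u b; rewrite scale1r.
- by move=> u v w b; rewrite kact_termD.
- by move=> u b; rewrite !scale0r.
- by move=> a c b; rewrite scalerDl.
- by move=> a c b; rewrite scalerA.
- by move=> a u b; rewrite kact_termZ.
- move=> t h b; rewrite invgK !mulrA kgenR -!mulrA; do 3 congr (_ * _).
  by rewrite !mulrA kgenL' invgM.
- move=> t h b; rewrite invgK !mulrA kgenL -!mulrA; do 3 congr (_ * _).
  by have := kgenR h^-1%g t^-1%g; rewrite invgK invgM -mulrA => ->.
- by move=> b; rewrite invg1 kgen1 scale1r mul1r mulr1.
Qed.

Definition kact (r b : kpar) : kpar := kact_term (repr r) b.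

Lemma kact_cls u b : kact (kcls u) b = kact_term u b.
Proof. exact/kact_rel/krepr_cls. Qed.

Lemma kact_gen t b : kact (kgen t) b = kgen t * b * kgen t^-1%g.
Proof. exact: kact_cls. Qed.

Lemma kact_term_in_kB u b : b \in in_kB -> kact_term u b \in in_kB.
Proof.
elim: u b => [t|a|u IHu v IHv|u IHu v IHv] b bB /=.
- have [c cB ->] : exists2 c, c \in in_kB & kgen t * b = c * kgen t.
    move: b bB; apply: in_kB_ind => [|s|a x y [c cB cE] [d dB dE]|x y [c cB cE] [d dB dE]].
    + by exists 1; rewrite ?rpred1 // mulr1 mul1r.
    + by exists (kidem (t * s)%g); rewrite ?kidem_in_kB // kgen_kidem.
    + exists (a *: c + d); first by rewrite rpredD ?rpredZ.
      by rewrite mulrDr mulrDl -scalerAr -scalerAl cE dE.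
    + by exists (c * d); rewrite ?rpredM // mulrA cE -mulrA dE mulrA.
  by rewrite -mulrA rpredM // kidem_in_kB.
- by rewrite rpredZ.
- by rewrite rpredD ?IHu ?IHv.
- by rewrite IHu ?IHv.
Qed.

(* B, as a left module over the partial group algebra *)
Definition kB := {b : kpar | b \in in_kB}.
HB.instance Definition _ := SubChoice.on kB.
HB.instance Definition _ := [SubChoice_isSubZmodule of kB by <:].

Definition kB_act (r : kpar) (b : kB) : kB :=
  exist _ (kact r (val b)) (kact_term_in_kB (repr r) (valP b)).

Lemma kB_scalerA r s b : kB_act r (kB_act s b) = kB_act (r * s) b.
Proof.
apply/val_inj => /=; have [[u ->] [v ->]] := (kcls_surj r, kcls_surj s).
by rewrite (kcls_mulE u v) !kact_cls.
Qed.
Lemma kB_scale1r : left_id 1 kB_act.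
Proof.
by move=> b; apply/val_inj; rewrite -[LHS]/(kact (kcls (KConst 1)) _) kact_cls /= scale1r.
Qed.
Lemma kB_scalerDr : right_distributive kB_act +%R.
Proof. by move=> r b c; apply/val_inj; apply: kact_termD. Qed.
Lemma kB_scalerDl b : {morph kB_act^~ b : r s / r + s}.
Proof.
move=> r s; apply/val_inj; have [[u ->] [v ->]] := (kcls_surj r, kcls_surj s).
rewrite -[RHS]/(kact (kcls u) (val b) + kact (kcls v) (val b)).
by rewrite (kcls_addE u v) -[LHS]/(kact (kcls _) (val b)) !kact_cls.
Qed.

HB.instance Definition _ := GRing.Zmodule_isLmodule.Build kpar kB
  kB_scalerA kB_scale1r kB_scalerDr kB_scalerDl.

Lemma kB_scale_gen t (b : kB) :
  val (kgen t *: b) = kgen t * val b * kgen t^-1%g.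
Proof. exact: kact_gen. Qed.

Lemma kB_scale_kB c (b : kB) : c \in in_kB -> val (c *: b) = c * val b.
Proof.
move=> cB; elim/in_kB_ind: cB b => [|t|a x y xb yb|x y xb yb] b.
- by rewrite scale1r mul1r.
- rewrite -scalerA !kB_scale_gen invgK.
  transitivity (kidem t * (val b * kidem t)); first by rewrite /kidem !mulrA.
  by rewrite -in_kB_comm_kidem ?(valP b) // mulrA kidem_idem.
- rewrite scalerDl mulrDl -yb -scalerAl -xb -[a *: x]mulr_algl -scalerA.
  rewrite -[LHS]/(kact a%:A (val (x *: b)) + val (y *: b)).
  by rewrite -kcls_constE kact_cls.
- by rewrite -scalerA xb yb mulrA.
Qed.

Definition kB_one : kB := exist _ 1 (rpred1 in_kB).

(* The augmentation map; kaug_homog gives its values on the homogeneous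
   components of the decomposition of kpar as the direct sum of the
   B (kidem t) (kgen t). *)
Definition kaug (r : kpar^o) : kB := r *: kB_one.

Lemma kaug_linear : linear kaug.
Proof. by move=> a x y; rewrite /kaug scalerDl scalerA. Qed.

HB.instance Definition _ :=
  GRing.isLinear.Build kpar kpar^o kB _ kaug kaug_linear.

Lemma kaug_homog t b : b \in in_kB -> val (kaug (b * kidem t * kgen t)) = b * kidem t.
Proof.
move=> bB; rewrite /kaug -scalerA kB_scale_kB; last exact: rpredM (kidem_in_kB t).
by rewrite kB_scale_gen /= mulr1 -mulrA kidem_idem.
Qed.

Definition kIG : lmodType kpar := submod (kerp kaug).

Definition is_cd_par (n : nat) : Prop := is_pdim (kB : lmodType kpar) n.

End PartialGroupAlgebra.
Arguments kgen K {G} t.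
Arguments kidem K {G} t.
Arguments kaug K G r : clear implicits.

Definition expgZ (G : groupType) (g : G) (i : int) : G :=
  match i with
  | Posz n => (g ^+ n)%g
  | Negz n => (g ^- n.+1)%g
  end.

(* The map i |-> g ^ i is a group morphism from Z to G; it is bijective exactly
   when G is infinite cyclic, generated by g. *)
Definition infinite_cyclic (G : groupType) (g : G) : Prop :=
  bijective (expgZ g).

Section InfiniteCyclic.
Variables (K : fieldType) (G : groupType) (g : G).

Local Notation R := (kpar K G).

Definition e_ (i : int) : R := kidem K (expgZ g i).
Definition f_ (i : int) : R := kgen K (expgZ g i) - e_ i.

(* R f_1 + ... + R f_k *)
Definition V_ (k : nat) : {pred R^o} := fun x =>
  `[< exists c : nat -> R, x = \sum_(1 <= i < k.+1) c i * f_ i%:Z >].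

Lemma V_closed k : submod_closed (V_ k).
Proof.
split=> [|a u v]; rewrite !unfold_in.
  by apply/asboolP; exists (fun _ => 0); rewrite big1 // => i _; rewrite mul0r.
move=> /asboolP[c ->] /asboolP[d ->]; apply/asboolP.
exists (fun i => a * c i + d i).
rewrite [_ *: _]mulr_sumr -big_split /=; apply: eq_bigr => i _.
by rewrite mulrDl mulrA.
Qed.

HB.instance Definition _ k := GRing.isSubmodClosed.Build R R^o (V_ k) (V_closed k).

Definition Vmod (k : nat) : lmodType R := submod (V_ k).

(* V_ k / V_ (k - 1), for k >= 1 *)
Definition Pmod (k : nat) : lmodType R := subquot (V_ k) (V_ k.-1).

Lemma V_subset k : {subset V_ k.-1 <= V_ k}.
Proof.
case: k => // k x; rewrite !unfold_in => /asboolP[c ->]; apply/asboolP.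
exists (fun i => if (i < k.+1)%N then c i else 0).
rewrite [RHS]big_nat_recr //= ltnn mul0r addr0.
by apply: eq_big_nat => i /andP[_ ->].
Qed.

Lemma f_in_IG i : f_ i \in kerp (kaug K G).
Proof.
rewrite unfold_in raddfB subr_eq0; apply/eqP/val_inj.
rewrite -[kgen K _]kidem_gen -[kidem K _]mul1r kaug_homog ?rpred1 //.
by rewrite /e_ kB_scale_kB ?kidem_in_kB //= mulr1 mul1r.
Qed.

Lemma V_sub_IG k : {subset V_ k <= kerp (kaug K G)}.
Proof.
move=> x; rewrite unfold_in => /asboolP[c ->].
by apply: rpred_sum => i _; apply: rpredZ (f_in_IG _).
Qed.

End InfiniteCyclic.
Arguments e_ K {G} g i.
Arguments f_ K {G} g i.
Arguments V_ K {G} g k x.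
Arguments Vmod K {G} g k.
Arguments Pmod K {G} g k.

(* Main.v *)
Require Import Defs.
From HB Require Import structures.
Set Warnings "-all".
From mathcomp Require Import all_boot all_order all_algebra.
From mathcomp Require Import boolp.

Set Implicit Arguments.
Unset Strict Implicit.
Unset Printing Implicit Defensive.

Import GRing.Theory.
Local Open Scope ring_scope.

(** A character of B, that is, a homomorphism from B to K, amounts to a subset
    A of Z containing 0: it sends e_i to 1 when i lies in A and to 0 otherwise.
    Over the point A the ring R behaves like the groupoid algebra of the moves
    of the base point inside A. The moves with a given end correspond to the
    points of A, the augmentation adds up their coefficients, and f_i is the
    move of length i minus the identity. As A lies on a line, a finite
    combination of its points with coefficients adding up to 0 is in a unique
    way a combination of differences of consecutive points: IG is freely
    generated, point by point of the spectrum, by the moves from one element of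
    A to the next.

    Algebraically, with 0-based indices, let gap j be the idempotent
    (1 - e_1) ... (1 - e_j) e_{j+1} of B; it is the indicator of the event that
    the point following 0 in A is j+1. The edge of length j+1 is
    edge j = gap j * f_{j+1}.

    - Edges suffice: a move that passes over an intermediate point splits,
      e_i f_{i+j} = [i] f_j + e_{i+j} f_i (kidem_IG). Hence f_{k+1} and edge k
      agree modulo V_k, and the edges of length at most k span V_k.
    - Edges are independent: there are linear maps edge_coord k from IG to R
      with edge_coord k (edge j) = 0 for j != k and
      edge_coord k (edge k) = gap k. To define such a map one need only say
      where the [t] - e_t go, subject to a cocycle identity (kIG_extend), and
      edge_coord k sends f_n to e_n * (gap k + [1] gap k + ... + [n-1] gap k):
      it collects the edges of length k+1 met on the way from 0 to n.

    So edge is a generating family with a dual family of coordinates, adapted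
    to the filtration by the V_k (cyclic_dual_system), and the projectivity of
    the V_k, of the quotients P_k and of IG, together with the decomposition of
    IG, are formal consequences. Each V_k meets only finitely many coordinates
    while no edge vanishes (take for A the multiples of k+1), so IG is not
    finitely generated. If B were
    projective, IG would be a direct summand of R, hence cyclic; therefore the
    projective dimension of B is exactly 1. Finally, the point A = {0} defines a
    character of R that kills every gap j, hence every value of every linear
    functional on IG (as edge j = gap j * edge j); a nonzero free module has a
    functional taking the value 1, so IG is not free. *)

(** * Linear maps, projective modules and short resolutions *)

Lemma pack_linear (R : pzRingType) (M N : lmodType R) (f : M -> N) :
  linear f -> exists h : {linear M -> N}, h =1 f.
Proof.
move=> lf; pose a := GRing.isLinear.Build R M N _ f lf.
by exists (HB.pack_for {linear M -> N} f a).
Qed.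

Lemma inj_surj_bijective (A B : Type) (f : A -> B) :
  injective f -> surjective_map f -> bijective f.
Proof.
move=> finj fsurj; exists (fun y => projT1 (cid (fsurj y))) => [x|y].
  by apply: finj; case: cid.
by case: cid.
Qed.

Section DualBasis.
Variables (R : pzRingType) (P : lmodType R).

(** A map defined on P is lifted by lifting the images of the u k and
    recombining them with the coordinates phi k. *)
Lemma dual_basis_projective (u : nat -> P) (phi : nat -> {linear P -> R^o}) :
  (forall x, exists n, (forall k, (n <= k)%N -> phi k x = 0) /\
                       x = \sum_(k < n) (phi k x : R) *: u k) ->
  projective P.
Proof.
move=> ex_n M N f g fsurj.
pose n x := projT1 (cid (ex_n x)).
have n_out x k : (n x <= k)%N -> phi k x = 0.
  by rewrite /n; case: cid => m [] /= + _; apply.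
have n_sum x : x = \sum_(k < n x) (phi k x : R) *: u k.
  by rewrite /n; case: cid => m [].
pose v k := projT1 (cid (fsurj (g (u k)))).
have fv k : f (v k) = g (u k) by rewrite /v; case: cid.
pose h x := \sum_(k < n x) (phi k x : R) *: v k.
have widen x m : (n x <= m)%N -> h x = \sum_(k < m) (phi k x : R) *: v k.
  move=> nm; rewrite /h (big_ord_widen _ (fun k => (phi k x : R) *: v k) nm).
  rewrite big_mkcond; apply: eq_bigr => k _; case: ifPn => //.
  by rewrite -leqNgt => /n_out ->; rewrite scale0r.
have [|h' h'E] := @pack_linear _ _ _ h.
  move=> a x y; pose m := maxn (n (a *: x + y)) (maxn (n x) (n y)).
  have [mxy mx my] : [/\ n (a *: x + y)%R <= m, n x <= m & n y <= m]%N.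
    by rewrite /m !leq_max !leqnn !orbT.
  rewrite !(widen _ m) // scaler_sumr -big_split; apply: eq_bigr => k _ /=.
  by rewrite linearP scalerDl -scalerA.
exists h' => x; rewrite h'E /h [in RHS](n_sum x) !linear_sum.
apply: eq_bigr => k _.
by rewrite !linearZ fv.
Qed.

End DualBasis.

Lemma regular_projective (R : pzRingType) : projective (R^o : lmodType R).
Proof.
move=> M N f g fsurj; have [m fm] := fsurj (g 1).
have [|h hE] := @pack_linear _ R^o M (fun x => (x : R) *: m).
  by move=> a x y; rewrite scalerDl -scalerA.
by exists h => x; rewrite hE linearZ fm -linearZ /= [_ *: _]mulr1.
Qed.

(** A projective kernel closes the resolution after one step; it goes on with
    zero modules, for which row vectors of length 0 serve. *)
Lemma pdim_le1 (R : pzRingType) (P M : lmodType R) (f : {linear P -> M}) :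
  projective P -> projective (submod (kerp f)) -> surjective_map f ->
  pdim_le M 1.
Proof.
move=> projP projK fsurj.
pose Z : lmodType R := 'rV[R]_0.
have Z0 (z : Z) : z = 0 by exact: thinmx0.
pose Q (i : nat) : lmodType R :=
  match i with 0 => P | 1 => submod (kerp f) | _ => Z end.
pose d (i : nat) : {linear Q i.+1 -> Q i} :=
  match i with 0 => (val : {linear submod (kerp f) -> P}) | _ => \0 end.
exists Q, d, f; split=> //.
- case=> [|[|i]] //= A B p s psurj; exists \0 => x.
  by rewrite (Z0 x) !linear0.
- move=> x; split=> [/eqP fx0|[y <-]].
    by exists (exist _ x fx0 : submod (kerp f)).
  by have /eqP := valP y.
- case=> [|i] x; last first.
    by split=> [_|_]; [exists 0; rewrite [RHS]Z0 [LHS]Z0 |].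
  split=> [x0|[y <-]] /=; last by [].
  by exists 0; apply: val_inj; exact: esym x0.
- by case=> [|[|i]].
Qed.

(** With nothing in degree 1, the augmentation of the resolution is injective,
    so M is isomorphic to its term of degree 0. *)
Lemma pdim_le0_projective (R : pzRingType) (M : lmodType R) :
  pdim_le M 0 -> projective M.
Proof.
case=> P [d] [aug] [projP aug_surj aug_ker _ P0] A B f g fsurj.
have aug_inj : injective aug.
  move=> x y /eqP; rewrite -subr_eq0 -raddfB => /eqP/aug_ker[z].
  by rewrite (P0 1%N isT z) raddf0 => /esym/eqP; rewrite subr_eq0 => /eqP.
have [h hE] := projP 0%N A B f (g \o aug : {linear P 0%N -> B}) fsurj.
have [inv augK invK] := inj_surj_bijective aug_inj aug_surj.
have [|s sE] := @pack_linear _ _ _ inv.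
  by move=> a x y; apply: aug_inj; rewrite linearP !invK.
exists (h \o s : {linear M -> A}) => x.
by rewrite /= hE /= sE invK.
Qed.

(** * Modules filtered by a generating family with dual coordinates *)

Section DualSystem.
Variables (R : pzRingType) (M : lmodType R).

(** Each V k.+1 is V k plus the cyclic module R u_k, and the coordinate phi k
    is zero at the other generators. The element phi k (u k) fixes u_k;
    it is not required to be 1, so that R u_k may be projective without being
    free. The coordinates are functions on M, linear on N, rather than linear
    maps on N: this spares coercions between the nested submodules V k and N. *)
Record dual_system (N : submodClosed M) (V : nat -> submodClosed M)
    (u : nat -> M) (phi : nat -> M -> R) : Prop := DualSystem {
  dsys_union : forall x, x \in N <-> exists k, x \in V k;
  dsys_bot : forall x, x \in V 0%N -> x = 0;
  dsys_step : forall k, {subset V k <= V k.+1};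
  dsys_gen : forall k, u k \in V k.+1;
  dsys_split : forall k x, x \in V k.+1 -> exists a, x - a *: u k \in V k;
  dsys_linear : forall k a x y, x \in N -> y \in N ->
    phi k (a *: x + y) = a * phi k x + phi k y;
  dsys_off : forall k j, j != k -> phi k (u j) = 0;
  dsys_diag : forall k, phi k (u k) *: u k = u k
}.

Arguments dsys_bot {N V u phi} _ {x} _.
Arguments dsys_step {N V u phi} _ {k x} _.
Arguments dsys_split {N V u phi} _ {k x} _.
Arguments dsys_linear {N V u phi} _ k a {x y} _ _.
Arguments dsys_off {N V u phi} _ {k j} _.

Variables (N : submodClosed M) (V : nat -> submodClosed M).
Variables (u : nat -> M) (phi : nat -> M -> R).
Hypothesis sys : dual_system N V u phi.

Lemma V_in_N k : {subset V k <= N}.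
Proof. by move=> x xV; apply/(dsys_union sys); exists k. Qed.

Lemma V_mono k l : (k <= l)%N -> {subset V k <= V l}.
Proof.
move=> /subnK <-; elim: (l - k)%N => // n IHn x /IHn; exact: (dsys_step sys).
Qed.

Lemma u_in_N k : u k \in N.
Proof. exact: V_in_N (dsys_gen sys k). Qed.

(** The generators have triangular position with respect to the filtration and
    the coordinates are orthogonal to them, so that peeling off one generator
    at a time recovers x from its coordinates. *)
Lemma V_coord k x : x \in V k ->
  (forall j, (k <= j)%N -> phi j x = 0) /\ x = \sum_(j < k) phi j x *: u j.
Proof.
elim: k x => [|k IHk] x xV.
  rewrite big_ord0 (dsys_bot sys xV); split=> // j _.
  have := dsys_linear sys j (-1) (rpred0 N) (rpred0 N).
  rewrite scaler0 addr0 mulN1r addNr.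
  by apply; apply: rpred0.
have [a /[dup] /IHk[y0 ysum] yV] := dsys_split sys xV; pose y := x - a *: u k.
have phix j : phi j x = a * phi j (u k) + phi j y.
  by rewrite -(dsys_linear sys) ?u_in_N ?(V_in_N yV) // addrC subrK.
have phiuk j : j != k -> phi j x = phi j y.
  by move=> jk; rewrite phix (dsys_off sys) ?mulr0 ?add0r // eq_sym.
split=> [j kj|]; first by rewrite phiuk ?y0 1?ltnW // gtn_eqF.
rewrite big_ord_recr /= phix y0 // addr0 -scalerA (dsys_diag sys).
under eq_bigr => j _ do rewrite phiuk ?(ltn_eqF (ltn_ord j)) //.
by rewrite -ysum subrK.
Qed.

(** Elements of S involve only generators lying in S, so the coordinates
    restrict to a dual basis of S. *)
Lemma submod_projective (S : submodClosed M) : {subset S <= N} ->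
  (forall x j, x \in S -> phi j x != 0 -> u j \in S) -> projective (submod S).
Proof.
move=> SN phiS.
have lin k : linear (fun x : submod S => phi k (val x) : R^o).
  by move=> a x y; rewrite linearP (dsys_linear sys) // SN ?(valP x) ?(valP y).
pose h k : {linear submod S -> R^o} := projT1 (cid (pack_linear (lin k))).
have hE k x : h k x = phi k (val x) by rewrite /h; case: cid.
pose w j : submod S := insubd (0 : submod S) (u j).
apply: (dual_basis_projective (u := w) (phi := h)).
move=> x; have /(dsys_union sys)[k xV] := SN _ (valP x); exists k.
have [phi0 xsum] := V_coord xV.
split=> [j /phi0 phij0|]; first by rewrite hE.
apply: val_inj; rewrite linear_sum {1}xsum /=; apply: eq_bigr => j _.
rewrite hE -[RHS]/((phi j (val x) : R) *: val (insubd (0 : submod S) (u j))).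
have [->|/phiS uS] := eqVneq (phi j (val x)) 0.
  by rewrite !scale0r.
by rewrite insubdK // uS // (valP x).
Qed.

Lemma V_projective k : projective (submod (V k)).
Proof.
apply: submod_projective => [|x j xV]; first exact: V_in_N.
have [phi0 _] := V_coord xV.
case: (leqP k j) => [/phi0 ->|jk _]; first by rewrite eqxx.
exact: V_mono jk _ (dsys_gen sys j).
Qed.

Lemma N_projective : projective (submod N).
Proof. by apply: submod_projective => // x j _ _; apply: u_in_N. Qed.

Local Notation P k := (subquot (V k.+1) (V k)).

Definition gr_cls k (x : submod (V k.+1)) : P k :=
  quotmod_pi (trace_in (V k.+1) (V k)) x.

Definition gr_gen k : P k := gr_cls (exist _ (u k) (dsys_gen sys k)).

Lemma gr_cls_linear k : linear (@gr_cls k).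
Proof.
move=> a x y; rewrite /gr_cls quotmod_piD; congr (_ + _).
exact: quotmod_piZ.
Qed.

Lemma gr_cls_eq k x y : gr_cls x = gr_cls y :> P k <-> val x - val y \in V k.
Proof.
rewrite -[val x - val y]/(val (x - y)).
exact: (@quotmod_pi_eq _ _ (trace_in (V k.+1) (V k))).
Qed.

(** phi k vanishes on V k, hence descends to the quotient. *)
Lemma gr_phi_ex k : exists h : {linear P k -> R^o},
  forall x, h (gr_cls x) = phi k (val x).
Proof.
pose h (y : P k) : R^o := phi k (val (quotmod_repr y)).
have hE x : h (gr_cls x) = phi k (val x).
  rewrite /h; set y := quotmod_repr _.
  have /gr_cls_eq yx : gr_cls y = gr_cls x by apply: quotmod_reprK.
  have [/(_ k (leqnn k)) dif0 _] := V_coord yx.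
  have N' z : val (z : submod (V k.+1)) \in N by apply: V_in_N (valP z).
  rewrite -[val y](subrK (val x)) -[val y - _]scale1r.
  rewrite (dsys_linear sys) ?N' ?(V_in_N yx) //.
  by rewrite dif0 mulr0 add0r.
have surj (y : P k) : exists x, y = gr_cls x.
  by exists (quotmod_repr y); rewrite /gr_cls quotmod_reprK.
have [|h' h'E] := @pack_linear _ _ _ h; last first.
  by exists h' => x; rewrite h'E.
move=> a y z; have [x ->] := surj y; have [x' ->] := surj z.
rewrite -gr_cls_linear !hE linearP (dsys_linear sys) //.
  exact: V_in_N (valP x).
exact: V_in_N (valP x').
Qed.

Lemma gr_cls_gen k x : gr_cls x = (phi k (val x) : R) *: gr_gen k.
Proof.
pose uk : submod (V k.+1) := exist _ (u k) (dsys_gen sys k).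
have -> : (phi k (val x) : R) *: gr_gen k = gr_cls ((phi k (val x) : R) *: uk).
  by rewrite -[RHS]/(quotmod_pi _ _) quotmod_piZ.
apply/gr_cls_eq; rewrite -[val (_ *: _)]/((phi k (val x) : R) *: u k).
have [a ayV] := dsys_split sys (valP x).
have [/(_ k (leqnn k)) y0 _] := V_coord ayV.
suff -> : phi k (val x) *: u k = a *: u k by [].
rewrite -[val x](subrK (a *: u k)) addrC.
rewrite (dsys_linear sys) ?u_in_N ?(V_in_N ayV) //.
by rewrite y0 addr0 -scalerA (dsys_diag sys).
Qed.

Lemma gr_projective k : projective (P k).
Proof.
have [h hE] := gr_phi_ex k.
pose phi' j : {linear P k -> R^o} := if j == k then h else \0.
apply: (dual_basis_projective (u := fun=> gr_gen k) (phi := phi')) => y.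
exists k.+1; split=> [j kj|]; first by rewrite /phi' gtn_eqF.
rewrite big_ord_recr /= big1 => [|j _]; last first.
  by rewrite /phi' ltn_eqF ?ltn_ord //= scale0r.
rewrite add0r /phi' eqxx; have <- : gr_cls (quotmod_repr y) = y.
  exact: quotmod_reprK.
by rewrite hE -gr_cls_gen.
Qed.

Lemma phi_lincomb (r : nat -> R) n j :
  phi j (\sum_(k < n) r k *: u k) =
  if (j < n)%N then r j * phi j (u j) else 0.
Proof.
have sumN m : \sum_(k < m) r k *: u k \in N.
  by apply: rpred_sum => k _; rewrite rpredZ // u_in_N.
elim: n => [|n IHn].
  by rewrite big_ord0; have [-> //] := V_coord (rpred0 (V 0%N)).
rewrite big_ord_recr /= addrC (dsys_linear sys) ?u_in_N //; last exact: sumN.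
rewrite [X in _ + X]IHn ltnS.
have [jn|nj|->] := ltngtP j n; last by rewrite addr0.
  by rewrite (dsys_off sys) ?mulr0 ?add0r // gtn_eqF.
by rewrite (dsys_off sys) ?mulr0 ?add0r // ltn_eqF.
Qed.

(** The map sends x to the family of the classes of the phi k x *: u k. It is
    injective because phi k recovers phi k x * phi k (u k) from the class, and
    surjective because each quotient is generated by the class of u k. *)
Lemma N_iso_gr : mod_iso (submod N) (dsum (fun k : nat => P k)).
Proof.
pose gr (k : nat) : lmodType R := P k.
pose F x k : P k := (phi k x : R) *: gr_gen k.
have F_coord k x : x \in V k -> forall j, (k <= j)%N -> F x j = 0.
  by move=> /V_coord[x0 _] j /x0; rewrite /F => ->; rewrite scale0r.
have F_fin x :
    x \in N -> (F x : dprodmod gr) \in @finite_support R nat gr.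
  move=> /(dsys_union sys)[k /F_coord xk]; rewrite unfold_in; apply/asboolP.
  exists (iota 0 k) => j; rewrite mem_iota /= add0n -leqNgt; exact: xk.
pose F' (x : submod N) : dsum gr :=
  exist _ (F (val x) : dprodmod gr) (F_fin _ (valP x)).
have [|H HE] := @pack_linear _ (submod N) (dsum gr) F'.
  move=> a x y; apply: val_inj; apply: functional_extensionality_dep => k.
  rewrite -[RHS]/(a *: F (val x) k + F (val y) k).
  rewrite -[LHS]/(F (a *: val x + val y) k) /F.
  rewrite (dsys_linear sys) ?(valP x) ?(valP y) //.
  by rewrite scalerDl scalerA.
exists H; apply: inj_surj_bijective.
- apply: raddf_inj => x Hx0.
  have F0 : val (F' x) = 0 by rewrite -HE [H x]Hx0.
  apply: val_inj; have /(dsys_union sys)[k /V_coord[_ ->]] := valP x.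
  rewrite big1 // => j _; have Fx0 : F (val x) j = 0.
    by rewrite -[RHS]/((0 : dprodmod gr) j) -F0.
  have [h hE] := gr_phi_ex j.
  have := congr1 h Fx0; rewrite linear0 linearZ hE /= => phi0.
  by rewrite -(dsys_diag sys) scalerA [_ * _]phi0 scale0r.
move=> y; have := valP y; rewrite unfold_in => /asboolP[s sP].
pose r k : R := phi k (val (quotmod_repr (val y k))).
have yE k : val y k = r k *: gr_gen k.
  by rewrite -gr_cls_gen; apply/esym/quotmod_reprK.
pose n := (\max_(i <- s) i).+1.
pose x := \sum_(k < n) r k *: u k.
have xN : x \in N by apply: rpred_sum => k _; rewrite rpredZ // u_in_N.
exists (exist _ x xN); rewrite HE; apply: val_inj.
apply: functional_extensionality_dep => j.
rewrite -[LHS]/(F x j) /F phi_lincomb.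
case: ifPn => [_|jn].
  by rewrite -scalerA -(gr_cls_gen (exist _ (u j) (dsys_gen sys j))) -yE.
rewrite scale0r sP //; apply: contra jn => js.
by rewrite ltnS (@leq_bigmax_seq _ s xpredT id).
Qed.

(** Finitely many generators lie in a common V m, on which phi m vanishes; but
    phi m does not vanish at u m. *)
Lemma N_not_fin_gen : (forall k, u k != 0) -> ~ fin_gen (submod N).
Proof.
move=> u_neq0 [n [s s_gen]].
have level i : {k | val (s i) \in V k}.
  by apply/cid/(dsys_union sys); exact: valP.
pose m := \max_i projT1 (level i).
have sV i : val (s i) \in V m.
  by apply: V_mono (projT2 (level i)); apply: leq_bigmax.
have [c uc] := s_gen (exist _ (u m) (u_in_N m)).
have umV : u m \in V m.
  have -> : u m = val (\sum_(i < n) c i *: s i) by rewrite -uc.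
  by rewrite linear_sum; apply: rpred_sum => i _; apply: rpredZ.
have [/(_ m (leqnn m)) phi0 _] := V_coord umV.
by have := u_neq0 m; rewrite -(dsys_diag sys) phi0 scale0r eqxx.
Qed.

End DualSystem.

(** * Generators and relations of the augmentation ideal *)

Section Derivation.
Variables (K : fieldType) (G : groupType).
Local Notation R := (kpar K G).
Local Notation B := (kB K G).
Variables (M : lmodType R) (T : G -> M).
Hypothesis T_cocycle : forall t s,
  kgen K t *: T s = kidem K t *: (T (t * s)%g - T t).

Lemma kgen_kB t (c : B) :
  kgen K t * val c = val (kgen K t *: c) * kgen K t.
Proof.
have e : kgen K t^-1%g * kgen K t = kidem K t^-1%g by rewrite /kidem invgK.
rewrite kB_scale_gen -mulrA e -mulrA -in_kB_comm_kidem ?(valP c) //.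
by rewrite mulrA kgen_idemr.
Qed.

Lemma kgen_kB_idem t (c : B) :
  val (kgen K t *: c) * kidem K t = val (kgen K t *: c).
Proof.
rewrite -in_kB_comm_kidem; last exact: (valP (kgen K t *: c)).
by rewrite kB_scale_gen !mulrA kidem_gen.
Qed.

Lemma cocycle1 : T 1%g = 0.
Proof. by have := T_cocycle 1 1; rewrite kgen1 scale1r mul1g subrr scaler0. Qed.

Lemma cocycleV t : kgen K t *: T t^-1%g = - (kidem K t *: T t).
Proof. by rewrite T_cocycle mulgV cocycle1 sub0r scalerN. Qed.

(** The partial derivation from R to M that takes the value
    kidem t *: T t at [t]: on products it obeys
    D (x y) = x (D y) + D x, except that D x has to be evaluated at y . 1, an
    element of B which need not be 1. The second argument keeps track of that
    element, so der_term u b stands for D (u b). *)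
Fixpoint der_term (u : kterm K G) (b : B) : M :=
  match u with
  | KGen t => val (kgen K t *: b) *: T t
  | KConst _ => 0
  | KAdd v w => der_term v b + der_term w b
  | KMul v w => kcls v *: der_term w b + der_term v (kcls w *: b)
  end.

Lemma der_gen t b : der_term (KGen K t) b = val (kgen K t *: b) *: T t.
Proof. by []. Qed.

Lemma der_mul v w b :
  der_term (KMul v w) b = kcls v *: der_term w b + der_term v (kcls w *: b).
Proof. by []. Qed.

Lemma der_termD u : {morph der_term u : b c / b + c}.
Proof.
elim: u => [t|a|v IHv w IHw|v IHv w IHw] b c.
- rewrite !der_gen -scalerDl; congr (_ *: _).
  by rewrite [in LHS]scalerDr.
- by rewrite /= addr0.
- by rewrite /= IHv IHw addrACA.
- by rewrite !der_mul scalerDr IHw IHv scalerDr addrACA.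
Qed.

Lemma der_term0 u : der_term u 0 = 0.
Proof. by apply: (addrI (der_term u 0)); rewrite -der_termD !addr0. Qed.

Lemma der_termZ u (a : K) b : der_term u (a%:A *: b) = a%:A *: der_term u b.
Proof.
have aC (x : R) : x * a%:A = a%:A * x by rewrite mulr_algr mulr_algl.
elim: u b => [t|c|v IHv w IHw|v IHv w IHw] b.
- rewrite !der_gen scalerA aC -scalerA kB_scale_kB ?rpredZ ?rpred1 //.
  by rewrite -scalerA.
- by rewrite /= scaler0.
- by rewrite /= scalerDr IHv IHw.
- by rewrite !der_mul scalerDr IHw -IHv !scalerA !aC.
Qed.

Lemma scale_kgen_kB t (c : B) (m : M) :
  kgen K t *: (val c *: m) = val (kgen K t *: c) *: (kgen K t *: m).
Proof. by rewrite !scalerA kgen_kB. Qed.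

Lemma scale_kB_kidem t (c : B) (m : M) :
  val (kgen K t *: c) *: (kidem K t *: m) = val (kgen K t *: c) *: m.
Proof. by rewrite scalerA kgen_kB_idem. Qed.

(** The cocycle condition is what makes der_term respect the relations between
    the symbols [t]; the axioms of algebras follow from its linearity in b. *)
Lemma der_rel u v b : krel u v -> der_term u b = der_term v b.
Proof.
move=> uv; elim: uv b => {u v}.
- by [].
- by move=> u v _ uv b; rewrite uv.
- by move=> u v w _ uv _ vw b; rewrite uv.
- by move=> u u' v v' _ uu' _ vv' b /=; rewrite uu' vv'.
- move=> u u' v v' /kclsE uu uu' /kclsE vv vv' b.
  by rewrite !der_mul vv' uu' uu vv.
- by move=> u v w b /=; rewrite addrA.
- by move=> u v b /=; rewrite addrC.
- by move=> u b /=; rewrite add0r.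
- by move=> u v w b; rewrite !der_mul -!kcls_mulE scalerDr !scalerA addrA.
- by move=> u b; rewrite der_mul kcls_constE !scale1r addr0.
- by move=> u b; rewrite der_mul kcls_constE scaler0 !scale1r add0r.
- by move=> u v w b; rewrite /= -kcls_addE scalerDl addrACA.
- by move=> u v w b; rewrite /= -kcls_addE scalerDr scalerDl der_termD addrACA.
- by move=> u b; rewrite der_mul kcls_constE !scale0r addr0.
- by move=> a b c; rewrite /= addr0.
- by move=> a b c; rewrite der_mul /= scaler0 addr0.
- by move=> a u b; rewrite !der_mul kcls_constE der_termZ scaler0 add0r addr0.
- move=> t h b.
  rewrite !der_mul !der_gen -!/(kgen K _) -kcls_mulE -!/(kgen K _).
  set c := kgen K h^-1 *: b.
  have thc : kgen K t *: (kgen K h *: c) = kgen K (t * h) *: c.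
    by rewrite /c !scalerA kgenR.
  have tTV : kgen K t *: (kgen K h *: T h^-1) =
             - (kidem K (t * h) *: (kgen K t *: T h)).
    by rewrite cocycleV scalerN !scalerA kgen_kidem.
  rewrite -scalerA !scale_kgen_kB thc tTV.
  rewrite scalerN scale_kB_kidem addKr T_cocycle mulgK scale_kB_kidem.
  by rewrite scalerBr subrK.
- move=> t h b.
  rewrite !der_mul !der_gen -!/(kgen K _) -kcls_mulE -!/(kgen K _).
  have thb : kgen K t^-1 *: (kgen K t *: (kgen K h *: b)) =
             kgen K t^-1 *: (kgen K (t * h) *: b).
    by rewrite !scalerA kgenL.
  have idt : kgen K t^-1 * kidem K t = kgen K t^-1.
    by have := kgen_idemr K t^-1; rewrite invgK.
  have tT : kgen K t^-1 *: T t = - (kidem K t^-1 *: T t^-1).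
    by have := cocycleV t^-1; rewrite invgK.
  have ttT : kgen K t^-1 *: (kgen K t *: T h) =
             kgen K t^-1 *: T (t * h)%g + kidem K t^-1 *: T t^-1%g.
    by rewrite T_cocycle scalerA idt scalerBr tT opprK.
  rewrite -scalerA !scale_kgen_kB thb ttT tT scalerN scalerDr scale_kB_kidem.
  by rewrite addNr addr0.
- by move=> b; rewrite der_gen cocycle1 scaler0.
Qed.

Definition der (x : R) (b : B) : M := der_term (repr x) b.

Lemma der_cls u b : der (kcls u) b = der_term u b.
Proof. exact/der_rel/krepr_cls. Qed.

Lemma derD x y b : der (x + y) b = der x b + der y b.
Proof.
have [u ->] := kcls_surj x; have [v ->] := kcls_surj y.
by rewrite kcls_addE !der_cls.
Qed.

Lemma derM x y b : der (x * y) b = x *: der y b + der x (y *: b).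
Proof.
have [u ->] := kcls_surj x; have [v ->] := kcls_surj y.
by rewrite kcls_mulE !der_cls.
Qed.

Lemma der_kgen t b : der (kgen K t) b = val (kgen K t *: b) *: T t.
Proof. exact: der_cls. Qed.

Lemma der0 x : der x 0 = 0.
Proof. exact: der_term0. Qed.

End Derivation.

(** The universal property of IG: the elements [t] - e_t generate it and satisfy
    the relations of kidem_IG, which the family kidem t *: T t satisfies when T
    is a partial cocycle. On IG the derivation is linear, because y . 1 = 0 for
    y in IG removes the twisted term of the product rule. *)
Lemma kIG_extend (K : fieldType) (G : groupType) (M : lmodType (kpar K G))
    (T : G -> M) :
  (forall t s, kgen K t *: T s = kidem K t *: (T (t * s)%g - T t)) ->
  exists phi : kpar K G -> M,
    (forall a x y, x \in kerp (kaug K G) -> y \in kerp (kaug K G) ->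
       phi (a * x + y) = a *: phi x + phi y) /\
    forall t, phi (kgen K t - kidem K t) = kidem K t *: T t.
Proof.
move=> Tc; pose phi x := der T x (kB_one K G); exists phi.
split=> [a x y xI yI|t].
  rewrite /phi derD // derM //.
  have /eqP xI' : kaug K G x == 0 := xI.
  by rewrite [x *: kB_one K G]xI' der0 addr0.
have der00 : der T 0 (kB_one K G) = 0.
  by apply: (addrI (der T 0 (kB_one K G))); rewrite -derD // !addr0.
have derN x : der T (- x) (kB_one K G) = - der T x (kB_one K G).
  by apply/eqP; rewrite -addr_eq0 -derD // addNr der00.
have val_t : val (kgen K t *: kB_one K G) = kidem K t.
  by rewrite kB_scale_gen mulr1.
have val_tt : val (kgen K t *: (kgen K t^-1%g *: kB_one K G)) = kidem K t.
  rewrite !kB_scale_gen mulr1 invgK !mulrA.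
  by rewrite -mulrA -[kgen K t * _]/(kidem K t) kidem_idem.
rewrite /phi derD // derN {2}/kidem derM // !der_kgen // val_t.
rewrite scale_kgen_kB val_tt cocycleV // scalerN.
by rewrite scalerA kidem_idem addNr subr0.
Qed.

(** The [t] - e_t generate IG as a left ideal. The stronger claim that
    x b - x . b lies in S for all b in B is stable under products, and b = 1
    gives the result since x . 1 = 0 on IG. *)
Lemma kIG_min (K : fieldType) (G : groupType) (S : {pred (kpar K G)^o}) :
  submod_closed S -> (forall t, kgen K t - kidem K t \in S) ->
  {subset kerp (kaug K G) <= S}.
Proof.
move=> Scl Sf x.
have [S0 SP] := Scl.
have SD u v : u \in S -> v \in S -> u + v \in S.
  by move=> uS vS; rewrite -[u]scale1r; apply: SP.
have SZ (a u : kpar K G) : u \in S -> a * u \in S.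
  by move=> uS; rewrite -[a * u]addr0; apply: (SP a u 0).
suff diffS : forall b : kB K G, x * val b - val (x *: b) \in S.
  rewrite unfold_in => /eqP x1; have := diffS (kB_one K G).
  by rewrite [x *: _]x1 /= mulr1 subr0.
elim/kpar_ind: x => [t|a|x y xS yS|x y xS yS] b.
- rewrite kgen_kB -(kgen_kB_idem t b) -mulrA kidem_gen -mulrBr.
  exact: SZ.
- by rewrite kB_scale_kB ?rpredZ ?rpred1 // subrr.
- rewrite scalerDl mulrDl opprD addrACA; exact: SD.
- have -> : x * y * val b - val ((x * y) *: b) =
      x * (y * val b - val (y *: b)) + (x * val (y *: b) - val (x *: (y *: b))).
    by rewrite mulrBr mulrA scalerA addrA subrK.
  by apply: SD => //; apply: SZ.
Qed.

(** * Integer powers *)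

Section ExpgZ.
Variables (G : groupType) (g : G).

Lemma expgZS i : expgZ g (i + 1) = (expgZ g i * g)%g.
Proof.
case: i => n; first by rewrite addrC -[1 + _]/(Posz n.+1) /= expgSr.
have -> : Negz n + 1 = - n%:Z by rewrite NegzE -addn1 PoszD opprD subrK.
have -> : expgZ g (- n%:Z) = (g ^- n)%g by case: n => [|n] //=; rewrite invg1.
by rewrite /= expgS invgM mulgVK.
Qed.

Lemma expgZD i j : expgZ g (i + j) = (expgZ g i * expgZ g j)%g.
Proof.
elim/int_rect: j => [|n IHn|n IHn]; first by rewrite addr0 mulg1.
  by rewrite -addn1 PoszD addrA !expgZS IHn mulgA.
apply: (mulIg g); rewrite -mulgA -!expgZS -addrA.
by have -> : - n.+1%:Z + 1 = - n%:Z by rewrite -addn1 PoszD opprD subrK.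
Qed.

Lemma expgZN i : expgZ g (- i) = (expgZ g i)^-1%g.
Proof. by apply: (mulIg (expgZ g i)); rewrite -expgZD addNr mulVg. Qed.

End ExpgZ.

(** * Relations between the generators of the augmentation ideal *)

Section Relations.
Variables (K : fieldType) (G : groupType).

Lemma kgenM t s : kgen K t * kgen K s = kidem K t * kgen K (t * s :> G)%g.
Proof. by rewrite /kidem kgenL' mulKg. Qed.

Lemma kgenV_IG t : kgen K t^-1%g * (kgen K t - kidem K t) =
  - (kgen K t^-1%g - kidem K t^-1%g) :> kpar K G.
Proof.
have eV : kgen K t^-1%g * kgen K t = kidem K t^-1%g by rewrite /kidem invgK.
by have := kgen_idemr K t^-1%g; rewrite mulrBr eV opprB invgK => ->.
Qed.

(** A move by t * s that passes through t is a move by t followed by a move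
    by s. *)
Lemma kidem_IG t s : kidem K t * (kgen K (t * s)%g - kidem K (t * s)%g) =
  kgen K t * (kgen K s - kidem K s) +
  kidem K (t * s)%g * (kgen K t - kidem K t) :> kpar K G.
Proof.
by rewrite !mulrBr kgen_kidem -kgenM addrA subrK [in RHS]kidemC.
Qed.

End Relations.

(** * The edges of the integer line *)

Section InfiniteCyclicIG.
Variables (K : fieldType) (G : groupType) (g : G).
Hypothesis g_cyclic : infinite_cyclic g.
Local Notation R := (kpar K G).
Local Notation X i := (kgen K (expgZ g i)).
Local Notation e := (e_ K g).
Local Notation f := (f_ K g).

Section Steps.
Variables (M : lmodType R) (q : M).

(** An oriented sum over the interval from 0 to i: the sign for i < 0 is the one
    that makes steps1 hold for all integers. *)
Definition steps (i : int) : M :=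
  match i with
  | Posz n => \sum_(a < n) X a *: q
  | Negz n => - \sum_(a < n.+1) X (Negz a) *: q
  end.

Lemma steps1 i : steps (i + 1) = steps i + X i *: q.
Proof.
case: i => n.
  by rewrite -[Posz n + 1]/(Posz (n + 1)) addn1 /= big_ord_recr.
have -> : Negz n + 1 = - n%:Z by rewrite NegzE -addn1 PoszD opprD subrK.
rewrite /= big_ord_recr /= opprD subrK.
by case: n => [|n] //=; rewrite !big_ord0 oppr0.
Qed.

(** Both sides change by [g^i][g^j] q = e_i [g^(i+j)] q when j increases
    by 1. *)
Lemma steps_cocycle i j : X i *: steps j = e i *: (steps (i + j) - steps i).
Proof.
have step n : X i *: steps (n + 1) - e i *: (steps (i + (n + 1)) - steps i) =
              X i *: steps n - e i *: (steps (i + n) - steps i).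
  rewrite addrA !steps1 scalerDr scalerA kgenM -expgZD -scalerA.
  rewrite -/(e i) [steps (i + n) + _ - _]addrAC [e i *: (_ - _ + _)]scalerDr.
  by rewrite opprD addrACA subrr addr0.
apply/eqP; rewrite -subr_eq0; apply/eqP.
elim/int_rect: j => [|n IHn|n IHn].
- by rewrite addr0 subrr /= big_ord0 !scaler0 subrr.
- by rewrite -addn1 PoszD step.
rewrite -step; have -> : - n.+1%:Z + 1 = - n%:Z.
  by rewrite -addn1 PoszD opprD subrK.
exact: IHn.
Qed.

End Steps.

(** The indicator of the subsets A of Z whose least positive element is j+1. *)
Definition gap (j : nat) : R := (\prod_(i < j) (1 - e i.+1%:Z)) * e j.+1%:Z.

Lemma e_in_kB i : e i \in @in_kB K G.
Proof. exact: kidem_in_kB. Qed.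

Lemma gap_prod_in_kB j : \prod_(i < j) (1 - e i.+1%:Z) \in @in_kB K G.
Proof. by apply: rpred_prod => i _; rewrite rpredB ?rpred1 ?e_in_kB. Qed.

Lemma gap_in_kB j : gap j \in @in_kB K G.
Proof. by rewrite rpredM ?gap_prod_in_kB ?e_in_kB. Qed.

Lemma mul_idem (x y : R) : x \in @in_kB K G -> y \in @in_kB K G ->
  x * x = x -> y * y = y -> (x * y) * (x * y) = x * y.
Proof.
move=> xB yB xx yy.
rewrite -mulrA [y * (x * y)]mulrA (in_kB_comm yB xB).
by rewrite -(mulrA x y) yy mulrA xx.
Qed.

Lemma gap_idem j : gap j * gap j = gap j.
Proof.
have ee i : e i * e i = e i by apply: kidem_idem.
apply: mul_idem (ee _); rewrite ?gap_prod_in_kB ?e_in_kB //.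
elim: j => [|j IHj]; first by rewrite big_ord0 mulr1.
rewrite big_ord_recr /=; apply: mul_idem => //; first exact: gap_prod_in_kB.
  by rewrite rpredB ?rpred1 ?e_in_kB.
by rewrite mulrBr mulr1 mulrBl mul1r ee subrr subr0.
Qed.

Lemma gap_end j : gap j * e j.+1%:Z = gap j.
Proof. by rewrite /gap -mulrA [e _ * e _]kidem_idem. Qed.

Lemma gap_inside i j : (i < j)%N -> gap j * e i.+1%:Z = 0.
Proof.
move=> ij; rewrite /gap -mulrA (in_kB_comm (e_in_kB _) (e_in_kB _)) mulrA.
suff -> : \prod_(i < j) (1 - e i.+1%:Z) * e i.+1%:Z = 0 by rewrite mul0r.
elim: j ij => // j IHj; rewrite ltnS leq_eqVlt big_ord_recr /= -mulrA.
case/predU1P=> [->|/IHj pe0].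
  by rewrite mulrBl mul1r [e _ * e _]kidem_idem subrr mulr0.
rewrite (in_kB_comm _ (e_in_kB _)) ?rpredB ?rpred1 ?e_in_kB //.
by rewrite mulrA pe0 mul0r.
Qed.

(** The least positive element of a subset is unique. *)
Lemma gap_orth i j : i != j -> gap i * gap j = 0.
Proof.
have lt_orth k l : (k < l)%N -> gap l * gap k = 0.
  move=> kl; rewrite [gap k]/gap (in_kB_comm (gap_prod_in_kB _) (e_in_kB _)).
  by rewrite mulrA gap_inside // mul0r.
rewrite neq_ltn => /orP[ij|ji]; last exact: lt_orth.
by rewrite (in_kB_comm (gap_in_kB _) (gap_in_kB _)) lt_orth.
Qed.

Definition edge (j : nat) : R^o := gap j * f j.+1%:Z.

Lemma edge_in_IG j : edge j \in kerp (kaug K G).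
Proof. exact: rpredZ (f_in_IG _ _ _). Qed.

(** The cocycle is the sum of the [g^a] gap k over 0 <= a < n. In
    phi (edge j) = gap j * (gap k + [g] gap k + ... + [g^j] gap k), every term
    but the first vanishes because gap j excludes the points 1, ..., j. *)
Lemma edge_coord_ex k : exists phi : R^o -> R,
  (forall a x y, x \in kerp (kaug K G) -> y \in kerp (kaug K G) ->
     phi (a *: x + y) = a * phi x + phi y) /\
  (forall j, phi (edge j) = gap j * gap k).
Proof.
have [log gK Kg] := g_cyclic.
pose S : int -> R^o := steps (gap k : R^o).
have [t s|phi [phi_lin phi_f]] := @kIG_extend K G R^o (fun t => S (log t)).
  have -> : log (t * s)%g = log t + log s by rewrite -[t]Kg -[s]Kg -expgZD !gK.
  by have := steps_cocycle (gap k : R^o) (log t) (log s); rewrite Kg /e_ Kg.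
exists phi; split=> // j.
have phi0 : phi 0 = 0.
  have := phi_lin (-1) 0 0; rewrite mulr0 addr0 scaleN1r addNr.
  by apply; apply: rpred0.
have := phi_lin (gap j) (f j.+1%:Z) 0.
rewrite !addr0 phi0 addr0 => -> //; last first.
- exact: rpred0.
- exact: f_in_IG.
rewrite phi_f gK -[_ *: (_ *: _)]/(gap j * (e j.+1%:Z * S j.+1%:Z)).
rewrite mulrA gap_end.
rewrite /S /= mulr_sumr big_ord_recl /=.
rewrite kgen1 scale1r big1 ?addr0 // => a _.
have gX : gap j * X a.+1%:Z = 0.
  by rewrite -kidem_gen mulrA -/(e a.+1%:Z) gap_inside ?mul0r.
by rewrite -[_ *: _]/(X a.+1%:Z * gap k) mulrA gX mul0r.
Qed.

Definition edge_coord k : R^o -> R := projT1 (cid (edge_coord_ex k)).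

Lemma edge_coord_linear k a x y :
  x \in kerp (kaug K G) -> y \in kerp (kaug K G) ->
  edge_coord k (a *: x + y) = a * edge_coord k x + edge_coord k y.
Proof. by rewrite /edge_coord; case: cid => phi [] /= + _; apply. Qed.

Lemma edge_coord_edge k j : edge_coord k (edge j) = gap j * gap k.
Proof. by rewrite /edge_coord; case: cid => phi []. Qed.

Lemma edge_coord_off k j : j != k -> edge_coord k (edge j) = 0.
Proof. by move=> jk; rewrite edge_coord_edge gap_orth. Qed.

Lemma edge_coord_diag k : edge_coord k (edge k) *: edge k = edge k.
Proof.
by rewrite edge_coord_edge gap_idem -[_ *: _]/(gap k * edge k) mulrA gap_idem.
Qed.

Local Notation V := (V_ K g).

Lemma V_mulr k a x : x \in V k -> a * x \in V k.
Proof. exact: rpredZ. Qed.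

Lemma V_add k x y : x \in V k -> y \in V k -> x + y \in V k.
Proof. exact: rpredD. Qed.

Lemma V_step k : {subset V k <= V k.+1}.
Proof. exact: (@V_subset K G g k.+1). Qed.

Lemma V_split_f k x : x \in V k.+1 ->
  exists a, x - a * f k.+1%:Z \in V k.
Proof.
rewrite unfold_in => /asboolP[c ->]; exists (c k.+1).
rewrite big_nat_recr //= addrK unfold_in; apply/asboolP; by exists c.
Qed.

Lemma f_last_in_V k : f k.+1%:Z \in V k.+1.
Proof.
rewrite unfold_in; apply/asboolP; exists (fun i => (i == k.+1)%:R).
rewrite big_nat_recr //= eqxx mul1r big_nat big1 ?add0r // => i /andP[_ ik].
by rewrite ltn_eqF // mul0r.
Qed.

Lemma V_le k l : (k <= l)%N -> {subset V k <= V l}.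
Proof.
by move=> /subnK <-; elim: (l - k)%N => // n IHn x /IHn; apply: V_step.
Qed.

Lemma f_in_V i k : (i <= k)%N -> f i%:Z \in V k.
Proof.
case: i => [_|i ik]; last exact: V_le ik _ (f_last_in_V i).
have -> : f 0%:Z = 0 by rewrite /f_ /e_ /kidem /= invg1 kgen1 mulr1 subrr.
exact: rpred0.
Qed.

(** A move of length k+1 through an intermediate point is made of two shorter
    moves. *)
Lemma inside_f_in_V i k : (i < k)%N -> e i.+1%:Z * f k.+1%:Z \in V k.
Proof.
move=> ik; have kE : expgZ g k.+1%:Z = (expgZ g i.+1%:Z * expgZ g (k - i)%:Z)%g.
  by rewrite -expgZD -PoszD addSn subnKC // ltnW.
rewrite /f_ /e_ kE kidem_IG -kE.
apply: V_add; apply: V_mulr; apply: f_in_V => //; exact: leq_subr.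
Qed.

(** Multiplying f_{k+1} by 1 - e_i only removes moves through the point i, which
    belong to V k; and e_{k+1} fixes f_{k+1}. *)
Lemma f_sub_edge_in_V k : f k.+1%:Z - edge k \in V k.
Proof.
rewrite /edge /gap -mulrA.
have -> : e k.+1%:Z * f k.+1%:Z = f k.+1%:Z.
  by rewrite /f_ mulrBr kidem_gen kidem_idem.
suff: forall m, (m <= k)%N ->
    f k.+1%:Z - \prod_(i < m) (1 - e i.+1%:Z) * f k.+1%:Z \in V k by apply.
elim=> [|m IHm] mk; first by rewrite big_ord0 mul1r subrr rpred0.
rewrite big_ord_recr /= -mulrA [(1 - _) * _]mulrBl mul1r mulrBr opprB addrCA.
by rewrite addrC V_add ?IHm 1?ltnW // V_mulr // inside_f_in_V.
Qed.

Lemma edge_in_V k : edge k \in V k.+1.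
Proof. exact/V_mulr/f_last_in_V. Qed.

Lemma V_split_edge k x : x \in V k.+1 -> exists a, x - a *: edge k \in V k.
Proof.
move=> /V_split_f[a xaV]; exists a.
rewrite -[_ *: _]/(a * edge k) -(subrK (a * f k.+1%:Z) x) -addrA -mulrBr.
by rewrite V_add // V_mulr // f_sub_edge_in_V.
Qed.

Lemma V0_eq0 x : x \in V 0%N -> x = 0.
Proof. by rewrite unfold_in => /asboolP[c ->]; rewrite big_geq. Qed.

Lemma IG_union x : x \in kerp (kaug K G) <-> exists k, x \in V k.
Proof.
split=> [|[k]]; last exact: V_sub_IG.
have [log gK Kg] := g_cyclic.
pose S : {pred R^o} := fun x => `[< exists k, x \in V k >].
suff sub : {subset kerp (kaug K G) <= S}.
  by move=> /sub; rewrite unfold_in => /asboolP.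
apply: kIG_min => [|t].
  split=> [|a u v]; rewrite !unfold_in.
    by apply/asboolP; exists 0%N; apply: rpred0.
  move=> /asboolP[k uV] /asboolP[l vV]; apply/asboolP; exists (maxn k l).
  apply: V_add; first by apply: V_mulr; apply: V_le uV; apply: leq_maxl.
  by apply: V_le vV; apply: leq_maxr.
rewrite unfold_in; apply/asboolP; rewrite -[t]Kg.
case: (log t) => n; first by exists n; apply: f_in_V.
(* A negative power reduces to the opposite one: f_{-i} = - [g^-i] f_i. *)
exists n.+1; rewrite -[_ - _]opprK NegzE expgZN -kgenV_IG -mulN1r mulrA.
exact/V_mulr/f_last_in_V.
Qed.

Lemma cyclic_dual_system :
  dual_system (M := R^o) (kerp (kaug K G)) (fun k => V k) edge edge_coord.
Proof.
split; first exact: IG_union.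
- exact: V0_eq0.
- exact: V_step.
- exact: edge_in_V.
- exact: V_split_edge.
- exact: edge_coord_linear.
- exact: edge_coord_off.
- exact: edge_coord_diag.
Qed.

End InfiniteCyclicIG.

(** * Functionals on free modules and split augmentations *)

(** A free module that is not zero has a basis element, and the coordinate at
    this element is such a functional. *)
Lemma free_mod_functional (R : pzRingType) (M : lmodType R) (x : M) :
  free_mod M -> x != 0 -> exists (l : {linear M -> R^o}) y, l y = 1.
Proof.
move=> [I [h [h' hK h'K]]] x_neq0.
have [i] : exists i, val (h x) i <> 0.
  apply/not_existsP => hx0; move/eqP: x_neq0; apply.
  apply: (can_inj hK); rewrite linear0; apply: val_inj.
  by apply: functional_extensionality_dep => i; exact: contrapT (hx0 i).
move=> _; pose D := dsum (fun _ : I => R^o : lmodType R).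
have [|coord coordE] := @pack_linear R D R^o (fun y => val y i) => //.
pose delta : dprodmod (fun _ : I => R^o : lmodType R) :=
  fun j => if j == i then 1 else 0.
have deltaP : delta \in @finite_support R I (fun=> R^o).
  rewrite unfold_in; apply/asboolP; exists [:: i] => j.
  by rewrite inE /delta => /negbTE->.
exists (coord \o h), (h' (exist _ delta deltaP)).
by rewrite /= h'K coordE /= /delta eqxx.
Qed.

(** A section h of aug splits off the kernel, which is generated by the
    projection 1 - h (aug 1) of the generator of R. *)
Lemma projective_augmentation_fin_gen (R : pzRingType) (M : lmodType R)
    (aug : {linear R^o -> M}) :
  surjective_map aug -> projective M -> fin_gen (submod (kerp aug)).
Proof.
move=> aug_surj projM.
have [h hE] := projM _ _ aug (idfun : {linear M -> M}) aug_surj.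
pose y : R^o := 1 - h (aug 1).
have yK : y \in kerp aug by rewrite unfold_in /y linearB [aug (h _)]hE subrr.
exists 1%N, (fun=> exist _ y yK) => x; exists (fun=> val x).
rewrite big_ord1; apply: val_inj.
rewrite -[RHS]/((val x : R) *: y) scalerBr -linearZ -linearZ /=.
have -> : (val x : R) *: (1 : R^o) = val x by rewrite [LHS]mulr1.
have /eqP -> := valP x.
by rewrite linear0 subr0.
Qed.

(** * Characters of a partial group algebra *)

Section Characters.
Variables (K : fieldType) (G : groupType).

(** The hypotheses make H a subgroup. Its indicator is multiplicative as soon as
    one of the two arguments lies in H, and the defining relations only ask for
    this. *)
Lemma subgroup_partial_rep (H : {pred G}) : 1%g \in H ->
  (forall t h, h \in H -> (t * h \in H)%g = (t \in H)) ->
  partial_rep (fun t => (t \in H)%:R : K^o).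
Proof.
move=> H1 HM.
have HV h : (h^-1 \in H)%g = (h \in H).
  apply/idP/idP => hH; last by rewrite -(HM _ h) // mulVg.
  by rewrite -(HM _ _ hH) mulgV.
split=> [t h|t h|]; last by rewrite H1.
  rewrite HV; case hH: (h \in H); last by rewrite !mulr0.
  by rewrite HM // mulr1.
rewrite HV; case tH: (t \in H); last by rewrite !mul0r.
rewrite !mul1r; congr ((nat_of_bool _)%:R); apply/idP/idP; last first.
  by move=> thH; rewrite -(mulKg t h) HM // HV.
by move=> hH; rewrite HM.
Qed.

Lemma subgroup_character (H : {pred G}) : 1%g \in H ->
  (forall t h, h \in H -> (t * h \in H)%g = (t \in H)) ->
  exists chi : {rmorphism kpar K G -> K},
    forall t, chi (kidem K t) = (t \in H)%:R.
Proof.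
move=> H1 HM; have pr := subgroup_partial_rep H1 HM.
have [chi_gen chi_lin chi_mul] := klift_universal pr.
pose chi := klift (fun t => (t \in H)%:R : K^o).
have chi_add : zmod_morphism chi.
  move=> x y; have := chi_lin (-1) y x.
  by rewrite -/chi !scaleN1r ![- _ + _]addrC.
pose a := GRing.isZmodMorphism.Build (kpar K G) K chi chi_add.
pose m := GRing.isMonoidMorphism.Build (kpar K G) K chi chi_mul.
exists (HB.pack_for {rmorphism kpar K G -> K} chi a m) => t.
rewrite /= /chi /kidem chi_mul.2 !chi_gen.
have -> : (t^-1 \in H)%g = (t \in H).
  apply/idP/idP => tH; last by rewrite -(HM _ t) // mulVg.
  by rewrite -(HM _ _ tH) mulgV.
by case: (t \in H); rewrite ?mulr1 ?mulr0.
Qed.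

End Characters.

Section Gaps.
Variables (K : fieldType) (G : groupType) (g : G).
Hypothesis g_cyclic : infinite_cyclic g.

(** The subgroup generated by g^(k+1) contains g^(k+1) and none of g, ..., g^k,
    so its character takes the value 1 at gap k. *)
Lemma gap_neq0 k : gap K g k != 0.
Proof.
have [log gK Kg] := g_cyclic.
have logM t h : log (t * h)%g = log t + log h.
  by rewrite -[t]Kg -[h]Kg -expgZD !gK.
pose H : {pred G} := fun t => (k.+1 %| log t)%Z.
have [||chi chiE] := @subgroup_character K G H.
- by rewrite unfold_in -[1%g]/(expgZ g 0) gK dvdz0.
- have inH t : (t \in H) = (log t \in dvdz k.+1) by [].
  by move=> t h; rewrite !inH logM => hH; rewrite rpredDr.
have chi_e i : chi (e_ K g i) = (k.+1 %| i)%Z%:R by rewrite chiE unfold_in gK.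
suff chi1 : chi (gap K g k) = 1.
  by apply: contra_eq_neq chi1 => ->; rewrite rmorph0 eq_sym oner_neq0.
rewrite rmorphM rmorph_prod chi_e dvdzz mulr1; apply: big1 => i _.
rewrite rmorphB rmorph1 chi_e dvdzE /= gtnNdvd ?subr0 //.
by rewrite ltnS ltn_ord.
Qed.

(** For the trivial subgroup, e_{k+1} is sent to 0. *)
Lemma trivial_character : exists chi : {rmorphism kpar K G -> K},
  forall k, chi (gap K g k) = 0.
Proof.
have [log gK Kg] := g_cyclic.
have [||chi chiE] := @subgroup_character K G (pred1 1%g).
- by rewrite inE.
- by move=> t h; rewrite !inE => /eqP ->; rewrite mulg1.
exists chi => k; rewrite rmorphM chiE inE -[1%g]/(expgZ g 0).
by rewrite (can_eq gK) mulr0.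
Qed.

Lemma edge_neq0 k : edge K g k != 0.
Proof.
apply: contraNneq (gap_neq0 k) => edge0.
have := edge_coord_edge K g_cyclic k k; rewrite edge0 gap_idem => <-.
have IG0 : 0 \in kerp (kaug K G) by apply: rpred0.
have := edge_coord_linear g_cyclic k (-1) IG0 IG0.
by rewrite scaler0 addr0 mulN1r addNr => ->.
Qed.

End Gaps.

Theorem theorem8p9 (K : fieldType) (G : groupType) (g : G) :
  infinite_cyclic g ->
  (forall x : (kpar K G)^o,
      x \in kerp (kaug K G) <->
      exists k : nat, (1 <= k)%N /\ x \in V_ K g k) /\
  (forall k : nat, (1 <= k)%N -> projective (Vmod K g k)) /\
  (forall k : nat, (1 <= k)%N -> projective (Pmod K g k)) /\
  mod_iso (kIG K G) (dsum (fun k : nat => Pmod K g k.+1)) /\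
  projective (kIG K G) /\
  is_cd_par K G 1 /\
  ~ fin_gen (kIG K G) /\
  ~ free_mod (kIG K G).
Proof.
move=> g_cyclic.
have sys := cyclic_dual_system K g_cyclic.
have IG_proj : projective (kIG K G) := N_projective sys.
have IG_nfg : ~ fin_gen (kIG K G) := N_not_fin_gen sys (edge_neq0 K g_cyclic).
have aug_surj : surjective_map (kaug K G).
  move=> b; exists (val b); apply: val_inj.
  by rewrite [LHS](kB_scale_kB (kB_one K G) (valP b)) mulr1.
split.
  move=> x; split=> [/(dsys_union sys)[k xV]|[k [_ xV]]].
    by exists k.+1; split=> //; apply: V_step.
  by apply/(dsys_union sys); exists k.
split=> [k _|].
  exact: (V_projective sys).
split=> [[//|k] _|].
  exact: (gr_projective sys).
split; first exact: (N_iso_gr sys).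
split=> //; split.
  split; first exact: (pdim_le1 (@regular_projective _) IG_proj aug_surj).
  case=> // /pdim_le0_projective projB; case: IG_nfg.
  exact: projective_augmentation_fin_gen aug_surj projB.
split=> // IG_free.
have [chi chi_gap] := trivial_character K g_cyclic.
pose u k : kIG K G := exist _ (edge K g k) (edge_in_IG K g k).
have u0_neq0 : u 0%N != 0.
  by apply: contraNneq (edge_neq0 K g_cyclic 0) => /(congr1 val) /= ->.
have [l [y ly1]] := free_mod_functional IG_free u0_neq0.
(* As u k = gap k *: u k, the factor chi (gap k) = 0 divides chi (l (u k)). *)
suff chi_l (x : kIG K G) : chi (l x) = 0.
  by have /eqP := chi_l y; rewrite ly1 rmorph1 oner_eq0.
have gap_u k : gap K g k *: u k = u k.
  apply: val_inj; rewrite /= -[LHS]/(gap K g k * (gap K g k * _)).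
  by rewrite mulrA gap_idem.
have [k /(V_coord sys)[_ xE]] := (dsys_union sys (val x)).1 (valP x).
have -> : x = \sum_(j < k) edge_coord g_cyclic j (val x) *: u j.
  by apply: val_inj; rewrite linear_sum.
rewrite linear_sum rmorph_sum big1 // => j _.
by rewrite linearZ rmorphM -gap_u linearZ rmorphM chi_gap mul0r mulr0.
Qed.
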